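(* Let $E_0$ be an ellipse inscribed in a convex quadrilateral $Q=Q(A_1,A_2,A_3,A_4)$. Let $q_j\in S_j$, $j=1,2,3,4$, denote the points of tangency of $E_0$ with the sides of $Q$, where $S_1=\overline{A_1A_2}$, $S_2=\overline{A_2A_3}$, $S_3=\overline{A_3A_4}$, $S_4=\overline{A_4A_1}$, and let $D_1=\overline{A_1A_3}$ and $D_2=\overline{A_2A_4}$ denote the diagonals of $Q$. Then: (i) If $Q$ is a type 1 midpoint diagonal quadrilateral, then the lines $\overleftrightarrow{q_2q_3}$ and $\overleftrightarrow{q_1q_4}$ are parallel to $D_2$. (ii) If $Q$ is a type 2 midpoint diagonal quadrilateral, then the lines $\overleftrightarrow{q_1q_2}$ and $\overleftrightarrow{q_3q_4}$ are parallel to $D_1$. (iii) If $Q$ is not a midpoint diagonal quadrilateral, then neither $\overleftrightarrow{q_1q_2}$ nor $\overleftrightarrow{q_3q_4}$ is parallel to $D_1$, and neither $\overleftrightarrow{q_2q_3}$ nor $\overleftrightarrow{q_1q_4}$ is parallel to $D_2$.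
   Context: $Q(A_1,A_2,A_3,A_4)$ denotes the quadrilateral with vertices $A_1,A_2,A_3,A_4$, listed in clockwise order starting with the lower left corner $A_1$. An ellipse (circles included) is inscribed in a convex quadrilateral $Q$ if it lies inside $Q$ and is tangent to each side of $Q$. A convex quadrilateral $Q$ is a midpoint diagonal quadrilateral if the intersection point of its diagonals coincides with the midpoint of at least one of the diagonals. It is of type 1 if the diagonals intersect at the midpoint of $D_2$, and of type 2 if they intersect at the midpoint of $D_1$ (a parallelogram is both). Two lines are called parallel also when they are equal; a line is parallel to a segment if it is parallel to the line containing it. *)

(* Defs.v *)
From mathcomp Require Import all_boot all_order all_algebra.
From mathcomp Require Import all_classical reals.
From mathcomp Require Import ring lra.

Set Implicit Arguments.
Unset Strict Implicit.
Unset Printing Implicit Defensive.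

Import Order.TTheory GRing.Theory Num.Theory.
Local Open Scope ring_scope.
Local Open Scope classical_set_scope.

Section Plane.
Context {R : realType}.
Implicit Types (P A B C D : 'rV[R]_2) (E L M : set 'rV[R]_2).

Definition xc P : R := P 0 0.
Definition yc P : R := P 0 1.

(* A line only when A != B; see tangency_points_distinct. *)
Definition line A B := [set P | exists t : R, P = A + t *: (B - A)].

Definition segment A B :=
  [set P | exists t : R, 0 <= t <= 1 /\ P = A + t *: (B - A)].

Definition midpoint A B := 2^-1 *: (A + B).

Definition parallel L M := L = M \/ L `&` M = set0.

(* Twice the signed area of the triangle ABC, negative when A, B, C are in
   clockwise order. *)
Definition orient A B C : R :=
  (xc B - xc A) * (yc C - yc A) - (yc B - yc A) * (xc C - xc A).

(* A strict right turn at each vertex: for four points this already forces the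
   closed polygonal line ABCD to be simple, with no three vertices collinear. *)
Definition convex_quad A B C D :=
  [/\ orient A B C < 0, orient B C D < 0, orient C D A < 0 & orient D A B < 0].

(* The closed region bounded by a convex quadrilateral, as the convex hull of
   its vertices. *)
Definition quad_region A B C D :=
  [set P | exists a b c d : R,
    [/\ 0 <= a, 0 <= b, 0 <= c & 0 <= d] /\
    a + b + c + d = 1 /\ P = a *: A + b *: B + c *: C + d *: D].

(* The curve with center c, semi-axes a and b (a = b allowed), and axes directed
   by the orthonormal frame (co, si), (- si, co). *)
Definition ellipse_curve (c : 'rV[R]_2) (co si a b : R) :=
  [set P | let x := (xc P - xc c) * co + (yc P - yc c) * si in
           let y := (yc P - yc c) * co - (xc P - xc c) * si in
           (x / a) ^+ 2 + (y / b) ^+ 2 = 1].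

Definition ellipse E :=
  exists (c : 'rV[R]_2) (co si a b : R),
    [/\ 0 < a, 0 < b, co ^+ 2 + si ^+ 2 = 1 & E = ellipse_curve c co si a b].

(* E touches the side AB at P: P is on that side, and the line AB is tangent to
   the ellipse E at P, i.e. meets it at P only. *)
Definition tangent_side_at E A B P :=
  segment A B P /\ E `&` line A B = [set P].

Definition inscribed E A B C D :=
  [/\ ellipse E, E `<=` quad_region A B C D &
      [/\ exists P, tangent_side_at E A B P, exists P, tangent_side_at E B C P,
          exists P, tangent_side_at E C D P & exists P, tangent_side_at E D A P]].

(* Type 1 (resp. 2): the diagonals meet at the midpoint of D_2 = BD
   (resp. D_1 = AC). *)
Definition midpoint_diagonal1 A B C D :=
  segment A C `&` segment B D = [set midpoint B D].

Definition midpoint_diagonal2 A B C D :=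
  segment A C `&` segment B D = [set midpoint A C].

Definition midpoint_diagonal A B C D :=
  midpoint_diagonal1 A B C D \/ midpoint_diagonal2 A B C D.

Lemma tangent_dir (c : 'rV[R]_2) co si a b A B P :
  0 < a -> 0 < b ->
  ellipse_curve c co si a b `&` line A B = [set P] ->
  let x := (xc P - xc c) * co + (yc P - yc c) * si in
  let y := (yc P - yc c) * co - (xc P - xc c) * si in
  let u := (xc B - xc A) * co + (yc B - yc A) * si in
  let v := (yc B - yc A) * co - (xc B - xc A) * si in
  x * u / a ^+ 2 + y * v / b ^+ 2 = 0.
Proof.
move=> a0 b0 EL x y u v.
have a1 : a != 0 by rewrite gt_eqF.
have b1 : b != 0 by rewrite gt_eqF.
have [EP [s Ps]] : (ellipse_curve c co si a b `&` line A B) P by rewrite EL.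
rewrite /ellipse_curve /= -/x -/y in EP.
set h := x * u / a ^+ 2 + y * v / b ^+ 2.
set k := u ^+ 2 / a ^+ 2 + v ^+ 2 / b ^+ 2.
have k0 : 0 <= k by rewrite addr_ge0 // divr_ge0 // sqr_ge0.
have [k_0|kn] := eqVneq k 0.
  have p1 : 0 <= u ^+ 2 / a ^+ 2 by rewrite divr_ge0 // sqr_ge0.
  have p2 : 0 <= v ^+ 2 / b ^+ 2 by rewrite divr_ge0 // sqr_ge0.
  have /eqP := k_0; rewrite /k paddr_eq0 // => /andP[].
  rewrite !mulf_eq0 !invr_eq0 !expf_eq0 /= (negPf a1) (negPf b1) !orbF.
  rewrite ?orbb => /eqP u0 /eqP v0.
  by rewrite /h u0 v0 !mulr0 !mul0r addr0.
pose t := - (2 * h / k).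
have : [set P] (P + t *: (B - A)).
  rewrite -EL; split; last first.
    by exists (s + t); rewrite {1}Ps -addrA -scalerDl.
  rewrite /ellipse_curve /= /xc /yc !mxE.
  rewrite -/(xc P) -/(yc P) -/(xc A) -/(yc A) -/(xc B) -/(yc B).
  have -> : (xc P + t * (xc B - xc A) - xc c) * co
    + (yc P + t * (yc B - yc A) - yc c) * si = x + t * u by rewrite /x /u; ring.
  have -> : (yc P + t * (yc B - yc A) - yc c) * co
    - (xc P + t * (xc B - xc A) - xc c) * si = y + t * v by rewrite /y /v; ring.
  have -> : ((x + t * u) / a) ^+ 2 + ((y + t * v) / b) ^+ 2
    = ((x / a) ^+ 2 + (y / b) ^+ 2) + t * (2 * h + t * k).
    by rewrite /h /k; field; rewrite a1 b1.
  by rewrite EP /t; field.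
move=> /= /eqP; rewrite -subr_eq0 addrAC subrr add0r scaler_eq0 => /orP[|].
  by rewrite oppr_eq0 !mulf_eq0 invr_eq0 (negPf kn) orbF pnatr_eq0 /= => /eqP.
move=> /eqP BA.
have e0 : xc B - xc A = 0 by move: (congr1 xc BA); rewrite /xc !mxE.
have e1 : yc B - yc A = 0 by move: (congr1 yc BA); rewrite /yc !mxE.
by rewrite /h /u /v e0 e1 !mul0r subr0 addr0 !mulr0 !mul0r addr0.
Qed.

Lemma tangency_points_distinct E A B C P Q :
  ellipse E -> orient A B C != 0 ->
  tangent_side_at E A B P -> tangent_side_at E B C Q -> P != Q.
Proof.
move=> [c [co [si [a [b [a0 b0 cs ->]]]]]] hO [_ h1] [_ h2].
apply/eqP => PQ; rewrite -{}PQ in h2.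
have a1 : a != 0 by rewrite gt_eqF.
have b1 : b != 0 by rewrite gt_eqF.
have [EP _] : (ellipse_curve c co si a b `&` line A B) P by rewrite h1.
have := tangent_dir a0 b0 h2; have := tangent_dir a0 b0 h1.
move: EP; rewrite /ellipse_curve /=.
pose x := (xc P - xc c) * co + (yc P - yc c) * si.
pose y := (yc P - yc c) * co - (xc P - xc c) * si.
pose u := (xc C - xc B) * co + (yc C - yc B) * si.
pose v := (yc C - yc B) * co - (xc C - xc B) * si.
pose u' := (xc B - xc A) * co + (yc B - yc A) * si.
pose v' := (yc B - yc A) * co - (xc B - xc A) * si.
rewrite -/x -/y -/u -/v -/u' -/v' => EP H1 H2.
have D : u' * v - v' * u = orient A B C.
  transitivity ((co ^+ 2 + si ^+ 2) * orient A B C).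
    by rewrite /u /u' /v /v' /orient; ring.
  by rewrite cs mul1r.
suff D0 : u' * v - v' * u = 0 by move: hO; rewrite -D D0 eqxx.
have Dx : (u' * v - v' * u) * x = 0.
  transitivity (a ^+ 2 * (v * (x * u' / a ^+ 2 + y * v' / b ^+ 2)
     - v' * (x * u / a ^+ 2 + y * v / b ^+ 2))); first by field; rewrite a1 b1.
  by rewrite H1 H2 !mulr0 subr0 mulr0.
have Dy : (u' * v - v' * u) * y = 0.
  transitivity (b ^+ 2 * (u' * (x * u / a ^+ 2 + y * v / b ^+ 2)
     - u * (x * u' / a ^+ 2 + y * v' / b ^+ 2))); first by field; rewrite a1 b1.
  by rewrite H1 H2 !mulr0 subr0 mulr0.
transitivity ((u' * v - v' * u) * ((x / a) ^+ 2 + (y / b) ^+ 2)).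
  by rewrite EP mulr1.
by rewrite mulrDr !exprMn !expr2 !mulrA Dx Dy !mul0r addr0.
Qed.

End Plane.

(* Main.v *)
(* An affine map turns the ellipse into a circle, on which the two tangent
   segments from the vertex A_i have the same length r_i. Hence the contact point
   on the side A_i A_(i+1) divides it in the ratio r_i : r_(i+1), and a chord
   joining the contact points of two sides at a vertex is parallel to the diagonal
   facing that vertex iff the two ends of this diagonal have equal tangent
   lengths. On the other hand the diagonals cut each other in the ratios r_1 : r_3
   and r_2 : r_4, so the same equality says that they meet at the midpoint of that
   diagonal. *)
Require Import Defs.
From mathcomp Require Import all_boot all_order all_algebra.
From mathcomp Require Import all_classical reals.
From mathcomp Require Import ring lra.

Set Implicit Arguments.
Unset Strict Implicit.
Unset Printing Implicit Defensive.

Import Order.TTheory GRing.Theory Num.Theory.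
Local Open Scope ring_scope.
Local Open Scope classical_set_scope.

(** * Lines, parallelism and division ratios in the plane *)

Lemma vec2P {R : realType} (P Q : 'rV[R]_2) :
  xc P = xc Q -> yc P = yc Q -> P = Q.
Proof.
move=> ex ey; apply/rowP => -[[|[|//]] i2].
  by move: ex; rewrite /xc; congr (P _ _ = Q _ _); exact: val_inj.
by move: ey; rewrite /yc; congr (P _ _ = Q _ _); exact: val_inj.
Qed.

Lemma xc_barycenter {R : realType} (A B : 'rV[R]_2) (t : R) :
  xc (A + t *: (B - A)) = xc A + t * (xc B - xc A).
Proof. by rewrite /xc !mxE. Qed.

Lemma yc_barycenter {R : realType} (A B : 'rV[R]_2) (t : R) :
  yc (A + t *: (B - A)) = yc A + t * (yc B - yc A).
Proof. by rewrite /yc !mxE. Qed.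

(** Lets a contact point be read from either end of its side, so that both contact points next to a
    vertex can be written from that vertex. *)
Lemma barycenterC {R : realType} (A B : 'rV[R]_2) (r s : R) : r + s != 0 ->
  A + (r / (r + s)) *: (B - A) = B + (s / (s + r)) *: (A - B).
Proof.
move=> rs0; have sr0 : s + r != 0 by rewrite addrC.
by apply: vec2P; rewrite ?xc_barycenter ?yc_barycenter; field; rewrite ?rs0 ?sr0.
Qed.

Lemma lineC {R : realType} (A B : 'rV[R]_2) : line A B = line B A.
Proof.
suff sub (C D : 'rV[R]_2) : line C D `<=` line D C by apply/seteqP.
move=> P [t ->]; exists (1 - t).
by apply: vec2P; rewrite ?xc_barycenter ?yc_barycenter; ring.
Qed.

Lemma parallel_cross {R : realType} (A B P Q : 'rV[R]_2) :
  parallel (line P Q) (line A B) ->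
  (xc Q - xc P) * (yc B - yc A) - (yc Q - yc P) * (xc B - xc A) = 0.
Proof.
case=> [PQ|PQ].
  have [s sP] : line A B P.
    by rewrite -PQ; exists 0; rewrite scale0r addr0.
  have [t tQ] : line A B Q.
    by rewrite -PQ; exists 1; rewrite scale1r addrC subrK.
  by rewrite sP tQ !xc_barycenter !yc_barycenter; ring.
apply/eqP/negPn/negP => d0.
(* Cramer's rule for the common point of the two lines. *)
pose d := (xc Q - xc P) * (yc B - yc A) - (yc Q - yc P) * (xc B - xc A).
pose s := ((xc A - xc P) * (yc B - yc A) - (yc A - yc P) * (xc B - xc A)) / d.
pose t := ((xc A - xc P) * (yc Q - yc P) - (yc A - yc P) * (xc Q - xc P)) / d.
suff : (line P Q `&` line A B) (P + s *: (Q - P)) by rewrite PQ.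
split; first by exists s.
exists t; apply: vec2P; rewrite ?xc_barycenter ?yc_barycenter /s /t /d; field;
  exact: d0.
Qed.

Lemma homothetic_parallel {R : realType} (A B C : 'rV[R]_2) (k : R) : k != 0 ->
  parallel (line (C + k *: (A - C)) (C + k *: (B - C))) (line A B).
Proof.
move=> k0.
(* The vector [(1 - k) *: (C - A)] carries [A] to its image under the homothety of center [C] and
   ratio [k]. The lines coincide when it is a multiple of [B - A] and are disjoint otherwise. *)
have [CAB|CAB] := pselect (exists t : R, (1 - k) *: (C - A) = t *: (B - A)).
  left; case: CAB => t tE.
  have tx : (1 - k) * (xc C - xc A) = t * (xc B - xc A).
    by move: (congr1 xc tE); rewrite /xc !mxE.
  have ty : (1 - k) * (yc C - yc A) = t * (yc B - yc A).
    by move: (congr1 yc tE); rewrite /yc !mxE.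
  apply/seteqP; split => P [s ->].
    exists (t + s * k).
    apply: vec2P; rewrite !(xc_barycenter, yc_barycenter).
      rewrite [in RHS]mulrDl -tx; ring.
    rewrite [in RHS]mulrDl -ty; ring.
  exists ((s - t) / k).
  apply: vec2P; rewrite !(xc_barycenter, yc_barycenter).
    transitivity (xc A + t * (xc B - xc A) + (s - t) * (xc B - xc A)).
      by ring.
    by rewrite -tx; field.
  transitivity (yc A + t * (yc B - yc A) + (s - t) * (yc B - yc A)).
    by ring.
  by rewrite -ty; field.
right; apply/seteqP; split => // P [[s Ps] [t Pt]]; apply: CAB.
exists (t - s * k).
have PP := etrans (esym Ps) Pt.
have := congr1 xc PP; have := congr1 yc PP.
by move=> ey ex; apply: vec2P; move: ex ey; rewrite /xc /yc !mxE => ex ey; lra.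
Qed.

(** Equal ratios give a homothety centered at [C]. Conversely, the cross product of the two
    directions is [(a - b) * orient A C B]. *)
Lemma corner_chord_parallel {R : realType} (A B C : 'rV[R]_2) (a b : R) :
  a != 0 -> orient A C B != 0 ->
  parallel (line (C + a *: (A - C)) (C + b *: (B - C))) (line A B) <-> a = b.
Proof.
move=> a0 CAB; split=> [/parallel_cross|<-]; last exact: homothetic_parallel.
rewrite !(xc_barycenter, yc_barycenter) => h.
have : (a - b) * orient A C B = 0 by rewrite -[RHS]h /orient; ring.
by move/eqP; rewrite mulf_eq0 (negPf CAB) orbF subr_eq0 => /eqP.
Qed.

(** The sum of the two orientations is the cross product of [C - A] and [D - B]; when it is nonzero,
    the diagonals share at most one point. *)
Lemma segments_meet {R : realType} (A B C D : 'rV[R]_2) (s t : R) :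
  0 <= s <= 1 -> 0 <= t <= 1 -> orient A B C + orient C D A != 0 ->
  A + s *: (C - A) = B + t *: (D - B) ->
  segment A C `&` segment B D = [set A + s *: (C - A)].
Proof.
move=> s01 t01 O0 E; apply/seteqP.
split => [P [[s' [_ Ps]] [t' [_ Pt]]]|P ->] /=; last first.
  by split; [exists s | exists t].
rewrite Ps; congr (_ + _ *: _).
have ex := congr1 xc E; have ey := congr1 yc E.
have PP := etrans (esym Ps) Pt.
have ex' := congr1 xc PP; have ey' := congr1 yc PP.
rewrite !xc_barycenter !yc_barycenter in ex ey ex' ey'.
have : (s - s') * (orient A B C + orient C D A) = 0.
  transitivity (
    (yc D - yc B) * ((xc A + s * (xc C - xc A)) - (xc A + s' * (xc C - xc A))) -
    (xc D - xc B) * ((yc A + s * (yc C - yc A)) - (yc A + s' * (yc C - yc A)))).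
    by rewrite /orient; ring.
  by rewrite ex ey ex' ey'; ring.
by move/eqP; rewrite mulf_eq0 (negPf O0) orbF subr_eq0 => /eqP ->.
Qed.

(** * Tangents to the unit circle *)

(** Centered coordinates along the axes, divided by the semi-axes, turn the ellipse into the unit
    circle. The tangent at [P] is then the polar of [P], whose equation both ends of the side
    satisfy. *)
Lemma ellipse_circle_coords {R : realType} (E : set 'rV[R]_2) : ellipse E ->
  exists X Y : 'rV[R]_2 -> R,
    [/\ forall A B t, X (A + t *: (B - A)) = X A + t * (X B - X A),
        forall A B t, Y (A + t *: (B - A)) = Y A + t * (Y B - Y A),
        forall A B, X A = X B -> Y A = Y B -> A = B &
        forall A B P, tangent_side_at E A B P ->
          [/\ X P ^+ 2 + Y P ^+ 2 = 1, X A * X P + Y A * Y P = 1 &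
              X B * X P + Y B * Y P = 1]].
Proof.
move=> [c [co [si [a [b [a0 b0 cs ->]]]]]].
have a1 : a != 0 by rewrite gt_eqF.
have b1 : b != 0 by rewrite gt_eqF.
exists (fun P => ((xc P - xc c) * co + (yc P - yc c) * si) / a).
exists (fun P => ((yc P - yc c) * co - (xc P - xc c) * si) / b).
split=> [A B t|A B t|A B|A B P].
- by rewrite xc_barycenter yc_barycenter; field.
- by rewrite xc_barycenter yc_barycenter; field.
- move=> /(mulIf (invr_neq0 a1)) ex /(mulIf (invr_neq0 b1)) ey.
  apply: vec2P; apply/eqP; rewrite -subr_eq0 -[_ - _]mul1r -cs; apply/eqP.
    transitivity (
      co * (((xc A - xc c) * co + (yc A - yc c) * si) -
            ((xc B - xc c) * co + (yc B - yc c) * si)) -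
      si * (((yc A - yc c) * co - (xc A - xc c) * si) -
            ((yc B - yc c) * co - (xc B - xc c) * si))); first by ring.
    by rewrite ex ey; ring.
  transitivity (
    si * (((xc A - xc c) * co + (yc A - yc c) * si) -
          ((xc B - xc c) * co + (yc B - yc c) * si)) +
    co * (((yc A - yc c) * co - (xc A - xc c) * si) -
          ((yc B - yc c) * co - (xc B - xc c) * si))); first by ring.
  by rewrite ex ey; ring.
move=> [[t [_ Pt]] EL].
have [EP _] : (ellipse_curve c co si a b `&` line A B) P by rewrite EL.
have := tangent_dir a0 b0 EL; move: EP; rewrite /ellipse_curve /=.
have Px : xc P = xc A + t * (xc B - xc A) by rewrite Pt xc_barycenter.
have Py : yc P = yc A + t * (yc B - yc A) by rewrite Pt yc_barycenter.
set x := (xc P - xc c) * co + (yc P - yc c) * si.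
set y := (yc P - yc c) * co - (xc P - xc c) * si.
set u := (xc B - xc A) * co + (yc B - yc A) * si.
set v := (yc B - yc A) * co - (xc B - xc A) * si.
move=> EP uv.
have xA : (xc A - xc c) * co + (yc A - yc c) * si = x - t * u.
  by rewrite /x /u Px Py; ring.
have yA : (yc A - yc c) * co - (xc A - xc c) * si = y - t * v.
  by rewrite /y /v Px Py; ring.
have xB : (xc B - xc c) * co + (yc B - yc c) * si = x - t * u + u.
  by rewrite -xA /u; ring.
have yB : (yc B - yc c) * co - (xc B - xc c) * si = y - t * v + v.
  by rewrite -yA /v; ring.
split=> //.
  (* At either end the polar equation is [EP] plus a multiple of the tangency condition [uv]. *)
  rewrite xA yA -[RHS]EP -[RHS]subr0 -[X in _ = _ - X](mulr0 t) -uv.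
  by field; rewrite a1 b1.
rewrite xB yB -[RHS]EP -[RHS]addr0 -[X in _ = _ + X](mulr0 (1 - t)) -uv.
by field; rewrite a1 b1.
Qed.

(** In the orthonormal basis [(a, b)], [(b, - a)] the point [(x, y)] has coordinates [1] and [r], so
    [r] is a signed tangent length. *)
Lemma tangent_point_param {R : comNzRingType} (x y a b r : R) :
  a ^+ 2 + b ^+ 2 = 1 -> x * a + y * b = 1 -> x * b - y * a = r ->
  x = a + r * b /\ y = b - r * a.
Proof.
move=> ab xy <-; split.
  transitivity (x * (a ^+ 2 + b ^+ 2)); first by rewrite ab mulr1.
  by rewrite -[X in _ = X + _]mulr1 -[X in _ = _ * X + _]xy; ring.
transitivity (y * (a ^+ 2 + b ^+ 2)); first by rewrite ab mulr1.
by rewrite -[X in _ = X - _]mulr1 -[X in _ = _ * X - _]xy; ring.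
Qed.

(** Both squared lengths equal [x ^+ 2 + y ^+ 2 - 1], so the signed lengths agree up to sign; equal
    ones would give equal contact points. *)
Lemma circle_tangent_lengths {R : realFieldType} (x y a b c d : R) :
  a ^+ 2 + b ^+ 2 = 1 -> c ^+ 2 + d ^+ 2 = 1 ->
  x * a + y * b = 1 -> x * c + y * d = 1 -> ~ (a = c /\ b = d) ->
  x * d - y * c = - (x * b - y * a) /\ x * b - y * a != 0.
Proof.
move=> ab cd xyab xycd ne.
have [ex ey] := tangent_point_param ab xyab erefl.
have [fx fy] := tangent_point_param cd xycd erefl.
set r := x * b - y * a in ex ey *; set s := x * d - y * c in fx fy *.
have sr : (s - r) * (s + r) = 0.
  have er : x ^+ 2 + y ^+ 2 = 1 + r ^+ 2.
    transitivity ((1 + r ^+ 2) * (a ^+ 2 + b ^+ 2)); last by rewrite ab mulr1.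
    by rewrite ex ey; ring.
  have es : x ^+ 2 + y ^+ 2 = 1 + s ^+ 2.
    transitivity ((1 + s ^+ 2) * (c ^+ 2 + d ^+ 2)); last by rewrite cd mulr1.
    by rewrite fx fy; ring.
  by rewrite -subr_sqr; lra.
have r1 : 1 + r ^+ 2 != 0 by rewrite gt_eqF // ltr_wpDr // sqr_ge0.
have neq : s != r.
  (* The vertex and [r] determine the contact point through a linear system of determinant
     [1 + r ^+ 2]. *)
  apply/eqP => sEr; apply: ne; split; apply: (mulfI r1); rewrite ?sEr in fx fy.
    transitivity (x - r * y); first by rewrite ex ey; ring.
    by rewrite fx fy; ring.
  transitivity (y + r * x); first by rewrite ex ey; ring.
  by rewrite fx fy; ring.
have sN : s = - r.
  by move/eqP: sr; rewrite mulf_eq0 subr_eq0 (negPf neq) addr_eq0 => /eqP.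
by split=> //; apply: contraNneq neq => r0; rewrite sN r0 oppr0.
Qed.

(* With i the clockwise quarter turn, the contact point u and the ends A, B of a
   side satisfy A = (1 - i r) u and B = (1 + i s) u, whence
   (1 + i s) A = (1 - i r) B. The difference of the two sides of the conclusion
   is r1 r2 ((1 + i r4) A3 - (1 - i r3) A4), where A1, A2, A3, A4 are first
   expressed through the first contact point. *)
Lemma circle_diagonals_meet {R : realFieldType}
    (r1 r2 r3 r4 a1 b1 a2 b2 a3 b3 a4 b4 x1 y1 x2 y2 x3 y3 x4 y4 : R) :
  x1 = a1 - r1 * b1 -> y1 = b1 + r1 * a1 ->
  x2 = a1 + r2 * b1 -> y2 = b1 - r2 * a1 ->
  x2 = a2 - r2 * b2 -> y2 = b2 + r2 * a2 ->
  x3 = a2 + r3 * b2 -> y3 = b2 - r3 * a2 ->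
  x3 = a3 - r3 * b3 -> y3 = b3 + r3 * a3 ->
  x4 = a3 + r4 * b3 -> y4 = b3 - r4 * a3 ->
  x4 = a4 - r4 * b4 -> y4 = b4 + r4 * a4 ->
  x1 = a4 + r1 * b4 -> y1 = b4 - r1 * a4 ->
  (r2 + r4) * (r3 * x1 + r1 * x3) = (r1 + r3) * (r4 * x2 + r2 * x4) /\
  (r2 + r4) * (r3 * y1 + r1 * y3) = (r1 + r3) * (r4 * y2 + r2 * y4).
Proof.
move=> X1 Y1 X2 Y2 X2' Y2' X3 Y3 X3' Y3' X4 Y4 X4' Y4' X1' Y1'.
have sq (r : R) : 1 + r ^+ 2 != 0 by rewrite gt_eqF // ltr_wpDr // sqr_ge0.
have A2 : a2 = (x2 + r2 * y2) / (1 + r2 ^+ 2).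
  by rewrite X2' Y2'; field; exact: sq.
have B2 : b2 = (y2 - r2 * x2) / (1 + r2 ^+ 2).
  by rewrite X2' Y2'; field; exact: sq.
have A4 : a4 = (x1 - r1 * y1) / (1 + r1 ^+ 2).
  by rewrite X1' Y1'; field; exact: sq.
have B4 : b4 = (y1 + r1 * x1) / (1 + r1 ^+ 2).
  by rewrite X1' Y1'; field; exact: sq.
have Ex : x3 + r4 * y3 - x4 + r3 * y4 = 0 by rewrite X3' Y3' X4 Y4; ring.
have Ey : y3 - r4 * x3 - y4 - r3 * x4 = 0 by rewrite X3' Y3' X4 Y4; ring.
have s1 := sq r1; have s2 := sq r2.
split; apply/eqP; rewrite -subr_eq0; apply/eqP.
  rewrite -[RHS](mulr0 (r1 * r2)) -Ex X3 Y3 X4' Y4' A2 B2 A4 B4 X1 Y1 X2 Y2.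
  by field; rewrite s1 s2.
rewrite -[RHS](mulr0 (r1 * r2)) -Ey X3 Y3 X4' Y4' A2 B2 A4 B4 X1 Y1 X2 Y2.
by field; rewrite s1 s2.
Qed.

(** * Division ratios on the sides and diagonals *)

(** Along the side, the determinant of the moving point with [(a, b)] is affine; it is [- r] and [s]
    at the ends and vanishes at the contact point. *)
Lemma contact_ratio {R : realFieldType} (x1 y1 x2 y2 a b r s t : R) :
  0 <= t <= 1 -> a = x1 + t * (x2 - x1) -> b = y1 + t * (y2 - y1) ->
  x1 * b - y1 * a = - r -> x2 * b - y2 * a = s -> r != 0 -> s != 0 ->
  0 < r * s /\ t = r / (r + s).
Proof.
move=> /andP[t0 t1] aE bE rE sE r0 s0.
have tr : t * (r + s) = r.
  have {}rE : r = y1 * a - x1 * b by rewrite -[r]opprK -rE opprB.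
  apply/eqP; rewrite -subr_eq0 -sE rE; apply/eqP.
  transitivity (b * (x1 + t * (x2 - x1)) - a * (y1 + t * (y2 - y1))).
    by ring.
  by rewrite -aE -bE mulrC subrr.
have rs0 : r + s != 0.
  by apply: contraNneq r0 => rs; rewrite -tr rs mulr0.
split; last by rewrite -{1}tr mulfK.
(* Here [r = t * (r + s)] and [s = (1 - t) * (r + s)]. *)
have rsE : r * s = t * (1 - t) * (r + s) ^+ 2.
  transitivity ((t * (r + s)) * ((r + s) - t * (r + s))); last by ring.
  by rewrite tr addrC addKr.
rewrite lt_def mulf_neq0 //= rsE.
by rewrite mulr_ge0 ?sqr_ge0 // mulr_ge0 ?subr_ge0.
Qed.

(* The weight of a vertex is, in coordinates where the ellipse is the unit
   circle, the common length of the two tangent segments from that vertex. *)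
Lemma inscribed_weights {R : realType} (A1 A2 A3 A4 : 'rV[R]_2)
    (E : set 'rV[R]_2) (q1 q2 q3 q4 : 'rV[R]_2) :
  ellipse E -> convex_quad A1 A2 A3 A4 ->
  tangent_side_at E A1 A2 q1 -> tangent_side_at E A2 A3 q2 ->
  tangent_side_at E A3 A4 q3 -> tangent_side_at E A4 A1 q4 ->
  exists r1 r2 r3 r4 : R,
    [/\ 0 < r1, 0 < r2, 0 < r3 & 0 < r4] /\
    [/\ q1 = A1 + (r1 / (r1 + r2)) *: (A2 - A1),
        q2 = A2 + (r2 / (r2 + r3)) *: (A3 - A2),
        q3 = A3 + (r3 / (r3 + r4)) *: (A4 - A3),
        q4 = A4 + (r4 / (r4 + r1)) *: (A1 - A4) &
        A1 + (r1 / (r1 + r3)) *: (A3 - A1) =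
        A2 + (r2 / (r2 + r4)) *: (A4 - A2)].
Proof.
move=> hE [O1 O2 O3 O4] h1 h2 h3 h4.
have [X [Y [Xaff Yaff XYinj tang]]] := ellipse_circle_coords hE.
have ne A B C P Q : orient A B C < 0 -> tangent_side_at E A B P ->
    tangent_side_at E B C Q -> ~ (X Q = X P /\ Y Q = Y P).
  move=> O hP hQ [ex ey].
  by case/eqP: (tangency_points_distinct hE (ltr0_neq0 O) hP hQ); apply: XYinj.
have [c1 t11 t12] := tang _ _ _ h1; have [c2 t22 t23] := tang _ _ _ h2.
have [c3 t33 t34] := tang _ _ _ h3; have [c4 t44 t41] := tang _ _ _ h4.
have [e1 n1] := circle_tangent_lengths c1 c4 t11 t41 (ne _ _ _ _ _ O4 h4 h1).
have [e2 n2] := circle_tangent_lengths c2 c1 t22 t12 (ne _ _ _ _ _ O1 h1 h2).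
have [e3 n3] := circle_tangent_lengths c3 c2 t33 t23 (ne _ _ _ _ _ O2 h2 h3).
have [e4 n4] := circle_tangent_lengths c4 c3 t44 t34 (ne _ _ _ _ _ O3 h3 h4).
move: e1 e2 e3 e4 n1 n2 n3 n4.
(* Each signed length is taken to the contact point on the side arriving at the vertex; on the side
   leaving it, the sign is reversed. *)
set r1 := X A1 * Y q4 - Y A1 * X q4; set r2 := X A2 * Y q1 - Y A2 * X q1.
set r3 := X A3 * Y q2 - Y A3 * X q2; set r4 := X A4 * Y q3 - Y A4 * X q3.
move=> /(canLR opprK)/esym e1 /(canLR opprK)/esym e2.
move=> /(canLR opprK)/esym e3 /(canLR opprK)/esym e4.
rewrite e1 e2 e3 e4 !oppr_eq0 => n1 n2 n3 n4.
have ratio A B P r s : segment A B P -> X A * Y P - Y A * X P = - r ->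
    X B * Y P - Y B * X P = s -> r != 0 -> s != 0 ->
    0 < r * s /\ P = A + (r / (r + s)) *: (B - A).
  move=> [t [t01 Pt]] rE sE r0 s0.
  have XP : X P = X A + t * (X B - X A) by rewrite Pt Xaff.
  have YP : Y P = Y A + t * (Y B - Y A) by rewrite Pt Yaff.
  by have [rs <-] := contact_ratio t01 XP YP rE sE r0 s0.
have [p12 q1E] := ratio _ _ _ _ _ h1.1 e1 erefl n1 n2.
have [p23 q2E] := ratio _ _ _ _ _ h2.1 e2 erefl n2 n3.
have [p34 q3E] := ratio _ _ _ _ _ h3.1 e3 erefl n3 n4.
have [p41 q4E] := ratio _ _ _ _ _ h4.1 e4 erefl n4 n1.
have [X11 Y11] := tangent_point_param c1 t11 e1.
have [X12 Y12] := tangent_point_param c1 t12 (erefl r2).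
have [X22 Y22] := tangent_point_param c2 t22 e2.
have [X23 Y23] := tangent_point_param c2 t23 (erefl r3).
have [X33 Y33] := tangent_point_param c3 t33 e3.
have [X34 Y34] := tangent_point_param c3 t34 (erefl r4).
have [X44 Y44] := tangent_point_param c4 t44 e4.
have [X41 Y41] := tangent_point_param c4 t41 (erefl r1).
rewrite !mulNr ?opprK in X11 Y11 X22 Y22 X33 Y33 X44 Y44.
have [mX mY] := circle_diagonals_meet X11 Y11 X12 Y12 X22 Y22 X23 Y23
  X33 Y33 X34 Y34 X44 Y44 X41 Y41.
(* Neighbouring weights have positive products, so all four share a sign. Which one is immaterial:
   negating all four preserves every ratio. *)
have same_sign : [/\ 0 < r1, 0 < r2, 0 < r3 & 0 < r4] \/
                 [/\ 0 < - r1, 0 < - r2, 0 < - r3 & 0 < - r4].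
  have [r1p|r1n] := ltP 0 r1; [left|right].
    have r2p : 0 < r2 by move: p12; rewrite pmulr_rgt0.
    have r3p : 0 < r3 by move: p23; rewrite pmulr_rgt0.
    by split=> //; move: p34; rewrite pmulr_rgt0.
  have {}r1n : r1 < 0 by rewrite lt_neqAle n1.
  have r2n : r2 < 0 by move: p12; rewrite nmulr_rgt0.
  have r3n : r3 < 0 by move: p23; rewrite nmulr_rgt0.
  by rewrite !oppr_gt0; split=> //; move: p34; rewrite nmulr_rgt0.
have [r13 r24] : r1 + r3 != 0 /\ r2 + r4 != 0.
  case: same_sign => -[s1 s2 s3 s4].
    by split; apply: lt0r_neq0; exact: addr_gt0.
  by split; rewrite -oppr_eq0 opprD; apply: lt0r_neq0; exact: addr_gt0.
have diag : A1 + (r1 / (r1 + r3)) *: (A3 - A1) =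
            A2 + (r2 / (r2 + r4)) *: (A4 - A2).
  have mean (x1 x2 x3 x4 : R) :
      (r2 + r4) * (r3 * x1 + r1 * x3) = (r1 + r3) * (r4 * x2 + r2 * x4) ->
      x1 + r1 / (r1 + r3) * (x3 - x1) = x2 + r2 / (r2 + r4) * (x4 - x2).
    move=> h; apply: (mulfI (mulf_neq0 r13 r24)).
    transitivity ((r2 + r4) * (r3 * x1 + r1 * x3)); first by field.
    by rewrite h; field.
  by apply: XYinj; rewrite ?Xaff ?Yaff; exact: mean.
case: same_sign => pos; first by exists r1, r2, r3, r4; split.
exists (- r1), (- r2), (- r3), (- r4); split => //.
by rewrite -!opprD !invrN !mulrNN; split.
Qed.

Theorem theorem3 (R : realType) (A1 A2 A3 A4 : 'rV[R]_2)
  (E0 : set 'rV[R]_2) (q1 q2 q3 q4 : 'rV[R]_2)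
  (hQ : convex_quad A1 A2 A3 A4)
  (hE0 : inscribed E0 A1 A2 A3 A4)
  (hq1 : tangent_side_at E0 A1 A2 q1)
  (hq2 : tangent_side_at E0 A2 A3 q2)
  (hq3 : tangent_side_at E0 A3 A4 q3)
  (hq4 : tangent_side_at E0 A4 A1 q4) :
  [/\ (midpoint_diagonal1 A1 A2 A3 A4 ->
         parallel (line q2 q3) (line A2 A4) /\
         parallel (line q1 q4) (line A2 A4)),
      (midpoint_diagonal2 A1 A2 A3 A4 ->
         parallel (line q1 q2) (line A1 A3) /\
         parallel (line q3 q4) (line A1 A3))
    & (~ midpoint_diagonal A1 A2 A3 A4 ->
         [/\ ~ parallel (line q1 q2) (line A1 A3),
             ~ parallel (line q3 q4) (line A1 A3),
             ~ parallel (line q2 q3) (line A2 A4)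
           & ~ parallel (line q1 q4) (line A2 A4)])].
Proof.
have [hE _ _] := hE0.
have [r1 [r2 [r3 [r4 [[p1 p2 p3 p4] [E1 E2 E3 E4 diag]]]]]] :=
  inscribed_weights hE hQ hq1 hq2 hq3 hq4.
have [O1 O2 O3 O4] := hQ.
have s0 (r s : R) : 0 < r -> 0 < s -> r + s != 0.
  by move=> r0 s0; rewrite gt_eqF ?addr_gt0.
have f0 (r s : R) : 0 < r -> 0 < s -> r / (r + s) != 0.
  by move=> r0 s0'; rewrite gt_eqF // divr_gt0 ?addr_gt0.
have f01 (r s : R) : 0 < r -> 0 < s -> 0 <= r / (r + s) <= 1.
  move=> r0 s0'; have rs := addr_gt0 r0 s0'.
  by rewrite ler_pdivrMr // mul1r lerDl (ltW s0') andbT ltW // divr_gt0.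
have feq (r s t : R) : 0 < r -> 0 < s -> 0 < t ->
    r / (r + s) = r / (r + t) <-> s = t.
  move=> r0 s0' t0; split=> [|->//].
  by move=> /(mulfI (lt0r_neq0 r0))/invr_inj/addrI.
(* Each contact point is now also written from the second end of its side. *)
have E1' := E1; rewrite barycenterC ?s0 // in E1'.
have E2' := E2; rewrite barycenterC ?s0 // in E2'.
have E3' := E3; rewrite barycenterC ?s0 // in E3'.
have E4' := E4; rewrite barycenterC ?s0 // in E4'.
(* Seen from [A2], the ratios are [r2 / (r2 + r1)] and [r2 / (r2 + r3)], equal exactly when
   [r1 = r3]. The other three vertices are alike, with lines reversed where needed to match an
   orientation in [hQ]. *)
have P12 : parallel (line q1 q2) (line A1 A3) <-> r1 = r3.
  rewrite E1' E2; apply: iff_trans (feq _ _ _ p2 p1 p3).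
  by apply: corner_chord_parallel; [exact: f0 | exact: ltr0_neq0].
have P34 : parallel (line q3 q4) (line A1 A3) <-> r3 = r1.
  rewrite E3' E4 (lineC A1); apply: iff_trans (feq _ _ _ p4 p3 p1).
  by apply: corner_chord_parallel; [exact: f0 | exact: ltr0_neq0].
have P23 : parallel (line q2 q3) (line A2 A4) <-> r2 = r4.
  rewrite E2' E3; apply: iff_trans (feq _ _ _ p3 p2 p4).
  by apply: corner_chord_parallel; [exact: f0 | exact: ltr0_neq0].
have P14 : parallel (line q1 q4) (line A2 A4) <-> r4 = r2.
  rewrite lineC (lineC A2) E1 E4'; apply: iff_trans (feq _ _ _ p1 p4 p2).
  by apply: corner_chord_parallel; [exact: f0 | exact: ltr0_neq0].
have O13 : orient A1 A2 A3 + orient A3 A4 A1 != 0.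
  by apply: ltr0_neq0; rewrite -[0]addr0 ltrD.
(* The diagonals meet only at the point with ratio [r1 / (r1 + r3)] on one and [r2 / (r2 + r4)] on
   the other, so a midpoint means a ratio of one half. *)
have meet := segments_meet (f01 _ _ p1 p3) (f01 _ _ p2 p4) O13 diag.
have half (r s : R) : 0 < r -> 0 < s -> r / (r + s) = 2^-1 <-> r = s.
  move=> r0 s0'; have rs := s0 _ _ r0 s0'; split=> [e|->].
    have : r = 2^-1 * (r + s) by rewrite -e divfK.
    by lra.
  by rewrite -mulr2n -[s *+ 2]mulr_natr invfM mulrA divff ?mul1r ?lt0r_neq0.
have mid (A B : 'rV[R]_2) (t : R) : A != B ->
    A + t *: (B - A) = midpoint A B <-> t = 2^-1.
  have -> : midpoint A B = A + 2^-1 *: (B - A).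
    by apply: vec2P; rewrite /xc /yc !mxE; lra.
  move=> AB; split=> [/addrI/eqP|->//].
  rewrite -subr_eq0 -scalerBl scaler_eq0 [B - A == 0]subr_eq0 [B == A]eq_sym.
  by rewrite (negPf AB) orbF subr_eq0 => /eqP.
have ne13 : A1 != A3.
  by apply: contraTneq O1 => ->; rewrite /orient !subrr !mulr0 subrr ltxx.
have ne24 : A2 != A4.
  by apply: contraTneq O2 => ->; rewrite /orient !subrr !mulr0 subrr ltxx.
have type2 : midpoint_diagonal2 A1 A2 A3 A4 <-> r1 = r3.
  rewrite /midpoint_diagonal2 meet -(half _ _ p1 p3) -(mid _ _ _ ne13).
  by split=> [/seteqP[/(_ _ erefl)]|->].
have type1 : midpoint_diagonal1 A1 A2 A3 A4 <-> r2 = r4.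
  rewrite /midpoint_diagonal1 meet diag -(half _ _ p2 p4) -(mid _ _ _ ne24).
  by split=> [/seteqP[/(_ _ erefl)]|->].
split.
- by move=> /type1 r24; split; [exact/P23 | exact/P14].
- by move=> /type2 r13; split; [exact/P12 | exact/P34].
move=> nmid; have n13 : r1 <> r3 by move=> /type2 ?; apply: nmid; right.
have n24 : r2 <> r4 by move=> /type1 ?; apply: nmid; left.
split.
- by move/P12.
- by move/P34/esym.
- by move/P23.
- by move/P14/esym.
Qed.
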